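(* Let $G$ be a triangle-free simple graph of order $n$ with $m$ edges and $q$ squares, and let $c_6$ be the number of closed walks of length $6$ in $G$. Then $$c_6\ge\frac{21m(4q-m)}{2}-\left(\frac{17}{2}-\frac{42}{n}\right)m^3.$$ Moreover, when $n$ is even, equality is realized by the complete bipartite graph with equal parts $K_{n/2,n/2}$.
   Context: If $\lambda_1,\dots,\lambda_n$ are the adjacency eigenvalues of $G$, then $c_6=\lambda_1^6+\cdots+\lambda_n^6$. The number of squares of $G$ is the number of $4$-cycles contained in $G$ as (not necessarily induced) subgraphs. *)

(* Defs.v *)
From HB Require Import structures.
From mathcomp Require Import all_boot all_order all_algebra.

Set Implicit Arguments.
Unset Strict Implicit.
Unset Printing Implicit Defensive.

Record sgraph := SGraph {
  svertex :> finType;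
  adj : rel svertex;
  adj_sym : symmetric adj;
  adj_irr : irreflexive adj }.

Arguments adj {s} x y.

Definition triangle_free (G : sgraph) : Prop :=
  forall x y z : G, ~~ [&& adj x y, adj y z & adj z x].

Definition edges (G : sgraph) : {set {set G}} :=
  [set [set p.1; p.2] | p : G * G & adj p.1 p.2].

(* A 4-cycle contained in G as a subgraph has no isolated vertices, so it is
   identified with its edge set. The eight 4-tuples that traverse the same
   4-cycle (four starting points, two directions) give the same element. *)
Definition cycle_edges (G : sgraph) (w : seq G) : {set {set G}} :=
  [set [set x; next w x] | x in w].

Definition squares (G : sgraph) : {set {set {set G}}} :=
  [set cycle_edges w | w : 4.-tuple G & uniq w && cycle adj w].

(* A walk of length k is the sequence of its k + 1 vertices; closed walks are
   counted with their starting point and direction, as in the trace of A^k. *)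
Definition closed_walks (G : sgraph) (k : nat) : {set k.+1.-tuple G} :=
  [set w : k.+1.-tuple G |
    sorted adj w && (tnth w ord0 == tnth w ord_max)].

Definition Kbip_rel (a b : nat) : rel ('I_a + 'I_b) :=
  fun x y =>
    match x, y with
    | inl _, inr _ | inr _, inl _ => true
    | _, _ => false
    end.

Lemma Kbip_sym (a b : nat) : symmetric (@Kbip_rel a b).
Proof. by case=> x [] y. Qed.

Lemma Kbip_irr (a b : nat) : irreflexive (@Kbip_rel a b).
Proof. by case. Qed.

Definition Kbip (a b : nat) : sgraph := SGraph (@Kbip_sym a b) (@Kbip_irr a b).

(* Main.v *)
Require Import Defs.
From HB Require Import structures.
From mathcomp Require Import all_boot all_order all_algebra.
From mathcomp Require Import zify ring lra.

Set Implicit Arguments.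
Unset Strict Implicit.
Unset Printing Implicit Defensive.

Import Order.TTheory GRing.Theory Num.Theory.

(** Write A for the adjacency matrix, d for the degrees, and c_k for the trace
    of A^k, that is, the number of closed walks of length k. A closed walk
    a b c d of length 4 is a traversal of a square unless a = c or b = d, and
    each square has 8 traversals, so inclusion-exclusion on these two
    coincidences gives ([squares_closed_walks4])
      8 q = c_4 - 2 sum d^2 + 2 m,   that is,   4 q - m = c_4 / 2 - sum d^2.
    The handshake lemma and the Cauchy-Schwarz inequality give
    sum d^2 >= 4 m^2 / n ([sum_deg_sqr_ge]), which is exactly what absorbs the
    term 42 m^3 / n. It remains to show c_6 >= (21/4) m c_4 - (17/2) m^3.

    In terms of the squared eigenvalues mu of A this reads
      sum mu (mu - m) (mu - 17 m / 4) >= 0,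
    and each summand is nonnegative once the spectral radius of a triangle-free
    graph is known to be at most the square root of m. No eigenvalue is needed
    though, because the cubic splits as mu (mu - m)^2 + (13/4) m mu (m - mu):
    - the first part sums to the sum of the squared entries of A^3 - m A, so
      c_6 - 2 m c_4 + 2 m^3 >= 0 in every graph ([closed_walks6_ge]);
    - the second part is nonnegative in sum as soon as c_4 <= 2 m^2, which in a
      triangle-free graph follows by matching closed walks of length 4 with
      pairs of oriented edges ([closed_walks4_le]).

    In K_{k,k} all degrees are k and A^3 = k^2 A, which gives c_4 and c_6, then
    q by the formula above, and the equality by computation. *)

(** * Counting over tuples and fibres *)

Lemma sum_tuple_cons (T : finType) k (F : k.+1.-tuple T -> nat) :
  \sum_w F w = \sum_x \sum_(w : k.-tuple T) F [tuple of x :: w].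
Proof.
rewrite pair_big /= (reindex (fun p : T * k.-tuple T => [tuple of p.1 :: p.2])) //=.
exists (fun w => (thead w, [tuple of behead w])) => [[x w] _ | w _] /=.
  by rewrite theadE; congr (_, _); apply/val_inj.
by rewrite -tuple_eta.
Qed.

Lemma sum_tuple_nil (T : finType) (F : 0.-tuple T -> nat) :
  \sum_w F w = F [tuple].
Proof.
rewrite (big_pred1 [tuple]) // => w; rewrite /= (tuple0 w).
exact/esym/eqP/val_inj.
Qed.

Lemma sum_pick (T : finType) (P : pred T) x : \sum_y (P y && (y == x)) = P x.
Proof.
rewrite (bigD1 x) //= eqxx andbT big1 ?addn0 // => y /negPf->.
by rewrite andbF.
Qed.

Lemma card_uniform_imset (T U : finType) (f : T -> U) (D : {set T}) k :
  {in D, forall x, #|[set y in D | f y == f x]| = k} ->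
  #|D| = k * #|f @: D|.
Proof.
move=> fibk; rewrite -sum1_card (partition_big_imset f) /= mulnC -sum_nat_const.
apply: eq_bigr => _ /imsetP[x Dx ->]; rewrite -(fibk x Dx) -sum1_card.
by apply: eq_bigl => y; rewrite inE.
Qed.

(** * Walks and powers of the adjacency matrix *)

Section Graph.
Variable G : sgraph.
Implicit Types x y z a b c d : G.

Definition deg x := \sum_y adj x y.

Lemma adj_neq x y : adj x y -> x != y.
Proof. by apply: contraTneq => ->; rewrite adj_irr. Qed.

(** The entries of the powers of the adjacency matrix, indexed by vertices so
    that no enumeration of the graph has to be chosen. *)
Fixpoint walks k x y : nat :=
  if k is k'.+1 then \sum_z adj x z * walks k' z y else x == y.

Lemma walks1 x y : walks 1 x y = adj x y.
Proof.
rewrite /= (bigD1 y) //= eqxx muln1 big1 ?addn0 // => z /negPf->.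
by rewrite muln0.
Qed.

Lemma walksD j k x y :
  walks (j + k) x y = \sum_z walks j x z * walks k z y.
Proof.
elim: j x => [|j IHj] x /=.
  rewrite (bigD1 x) //= eqxx mul1n big1 ?addn0 // => z.
  by rewrite eq_sym => /negPf->.
under [RHS]eq_bigr do rewrite big_distrl /=.
rewrite exchange_big /=; apply: eq_bigr => z _.
by rewrite IHj big_distrr /=; apply: eq_bigr => t _; rewrite mulnA.
Qed.

Lemma walksC k x y : walks k x y = walks k y x.
Proof.
elim: k x y => [|k IHk] x y; first by rewrite /= eq_sym.
rewrite -[in RHS]addn1 walksD; apply: eq_bigr => z _.
by rewrite walks1 mulnC IHk adj_sym.
Qed.

Lemma sum_walk_tuples k x y :
  \sum_(w : k.-tuple G) (path adj x w && (last x w == y)) = walks k x y.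
Proof.
elim: k x => [|k IHk] x /=; first by rewrite sum_tuple_nil.
rewrite sum_tuple_cons; apply: eq_bigr => z _; rewrite -IHk big_distrr /=.
by apply: eq_bigr => w _; rewrite mulnb andbA.
Qed.

Arguments walks : simpl never.

Lemma card_closed_walks k : #|closed_walks G k| = \sum_x walks k x x.
Proof.
rewrite -sum1_card big_mkcond sum_tuple_cons; apply: eq_bigr => x _.
rewrite -sum_walk_tuples; apply: eq_bigr => w _.
rewrite inE /= (tnth_nth x) (tnth_nth x) /= eq_sym.
rewrite [nth _ _ _](_ : _ = last x w); last first.
  by rewrite (last_nth x) size_tuple.
by case: (path _ _ _ && _).
Qed.

(** The trace of A^(2k) is the sum of the squared entries of A^k because A^k
    is symmetric. *)
Lemma closed_walks_sqr k :
  \sum_x walks (k + k) x x = \sum_x \sum_y walks k x y ^ 2.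
Proof.
apply: eq_bigr => x _; rewrite walksD; apply: eq_bigr => y _.
by rewrite [walks k y x]walksC mulnn.
Qed.

Definition closed4 a b c d : bool :=
  [&& adj a b, adj b c, adj c d & adj d a].

Lemma closed_walks4E :
  \sum_x walks 4 x x = \sum_a \sum_b \sum_c \sum_d closed4 a b c d.
Proof.
apply: eq_bigr => a _; rewrite -[4]/(1 + 3) walksD; apply: eq_bigr => b _.
rewrite walks1 -[3]/(1 + 2) walksD big_distrr; apply: eq_bigr => c _.
rewrite walks1 -[2]/(1 + 1) walksD !big_distrr; apply: eq_bigr => d _.
by rewrite !walks1 /= !mulnb.
Qed.

(** * Edges, squares and closed walks of length 4 *)

Lemma set2_eq x y a b : x != y -> [set x; y] = [set a; b] ->
  (x = a /\ y = b) \/ (x = b /\ y = a).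
Proof.
move=> xy E; have := set21 x y; have := set22 x y; rewrite E !inE.
by move=> /orP[] /eqP ? /orP[] /eqP ?; subst; rewrite ?eqxx in xy; auto.
Qed.

(** The handshake lemma: an edge is the image of exactly two ordered pairs of
    adjacent vertices. *)
Lemma sum_deg : \sum_x deg x = 2 * #|edges G|.
Proof.
rewrite /edges -(card_uniform_imset (k := 2)) /=; last first.
  move=> [x y]; rewrite inE /= => xy.
  have xNy := adj_neq xy.
  rewrite (_ : [set _ in _ | _] = [set (x, y); (y, x)]).
    by rewrite cards2 xpair_eqE (negPf xNy).
  apply/setP => -[z t]; rewrite !inE /= !xpair_eqE; apply/andP/orP.
    case=> zt /eqP E.
    by case: (set2_eq (adj_neq zt) E) => [[-> ->]|[-> ->]]; rewrite !eqxx; auto.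
  by case=> /andP[/eqP-> /eqP->]; rewrite ?xy ?eqxx // adj_sym xy setUC.
by rewrite pair_big /= -sum1_card [RHS]big_mkcond; apply: eq_bigr => p _;
   rewrite !inE; case: adj.
Qed.

(** A rewriting rule: it evaluates the equality tests left by [next] and by
    membership in explicit sequences. *)
Lemma uniq4_eqF a b c d : uniq [:: a; b; c; d] ->
  ((a == b = false) * (a == c = false) * (a == d = false) * (b == c = false) *
   (b == d = false) * (c == d = false)) *
  ((b == a = false) * (c == a = false) * (d == a = false) * (c == b = false) *
   (d == b = false) * (d == c = false)).
Proof.
rewrite /= !inE !negb_or -!andbA => /and4P[ab ac ad /and4P[bc bd cd _]].
by do 6?split; apply: negbTE => //; rewrite eq_sym.
Qed.

Lemma cycle_edges4 a b c d : uniq [:: a; b; c; d] ->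
  cycle_edges [:: a; b; c; d] =
    [set [set a; b]; [set b; c]; [set c; d]; [set d; a]].
Proof.
move=> U; pose neqs := (uniq4_eqF U, eqxx); apply/setP => e; rewrite !inE.
apply/imsetP/idP.
  by case=> x; rewrite !inE => /or4P[] /eqP-> -> /=; rewrite !neqs ?orbT.
rewrite -!orbA => /or4P[] /eqP->; [exists a|exists b|exists c|exists d];
  by rewrite ?inE ?eqxx ?orbT //= ?neqs.
Qed.

Definition cycles4 : {set 4.-tuple G} :=
  [set w : 4.-tuple G | uniq w && cycle adj w].

Lemma cycles4E a b c d :
  ([tuple a; b; c; d] \in cycles4) = [&& a != c, b != d & closed4 a b c d].
Proof.
rewrite inE /= !andbT -/(closed4 a b c d).
case: (boolP (closed4 a b c d)) => [|_]; last by rewrite !andbF.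
case/and4P=> /adj_neq ab /adj_neq bc /adj_neq cd /adj_neq.
rewrite eq_sym => ad; rewrite !inE !negb_or ab bc cd ad !andbT /=.
by case: (a != c).
Qed.

Lemma cycles4_uniq a b c d :
  [tuple a; b; c; d] \in cycles4 -> uniq [:: a; b; c; d].
Proof. by rewrite inE => /andP[]. Qed.

Lemma cycle_edges_rot a b c d (w := [tuple a; b; c; d])
    (w' := [tuple b; c; d; a]) : w \in cycles4 ->
  w' \in cycles4 /\ cycle_edges w' = cycle_edges w.
Proof.
move=> ww; have w'w : w' \in cycles4.
  move: ww; rewrite !cycles4E /closed4 (eq_sym c a).
  by case/and3P=> -> -> /and4P[-> -> -> ->].
split=> //; rewrite !cycle_edges4 ?cycles4_uniq //.
by apply/setP => e; rewrite !inE; do 4!case: (e == _).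
Qed.

Lemma cycle_edges_rev a b c d (w := [tuple a; b; c; d])
    (w' := [tuple d; c; b; a]) : w \in cycles4 ->
  w' \in cycles4 /\ cycle_edges w' = cycle_edges w.
Proof.
move=> ww; have w'w : w' \in cycles4.
  move: ww; rewrite !cycles4E /closed4 (eq_sym c a) (eq_sym d b).
  rewrite (adj_sym d c) (adj_sym c b) (adj_sym b a) (adj_sym a d).
  by case/and3P=> -> -> /and4P[-> -> -> ->].
split=> //; rewrite !cycle_edges4 ?cycles4_uniq //.
rewrite [[set d; c]]setUC [[set c; b]]setUC [[set b; a]]setUC [[set a; d]]setUC.
by apply/setP => e; rewrite !inE; do 4!case: (e == _).
Qed.

(** The orbit of (a, b, c, d) under the dihedral group of order 8. *)
Definition traversals a b c d : seq (4.-tuple G) :=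
  [:: [tuple a; b; c; d]; [tuple b; c; d; a]; [tuple c; d; a; b];
      [tuple d; a; b; c]; [tuple d; c; b; a]; [tuple c; b; a; d];
      [tuple b; a; d; c]; [tuple a; d; c; b]].

Lemma cycle_edges_traversals a b c d (w := [tuple a; b; c; d]) :
  w \in cycles4 ->
  forall w', w' \in traversals a b c d ->
  w' \in cycles4 /\ cycle_edges w' = cycle_edges w.
Proof.
move=> w1; have [w2 e2] := cycle_edges_rot w1.
have [w3 e3] := cycle_edges_rot w2; have [w4 e4] := cycle_edges_rot w3.
have [v1 f1] := cycle_edges_rev w1; have [v2 f2] := cycle_edges_rot v1.
have [v3 f3] := cycle_edges_rot v2; have [v4 f4] := cycle_edges_rot v3.
rewrite e2 in e3; rewrite e3 in e4; rewrite f1 in f2; rewrite f2 in f3.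
rewrite f3 in f4; move=> w'; rewrite !in_cons in_nil orbF.
by do 7?[case/orP]; move=> /eqP->.
Qed.

(** A traversal is determined by its first oriented edge, for which there are
    8 choices: at every later vertex only one of the two edges of the square
    does not turn back. *)
Lemma card_traversals w : w \in cycles4 ->
  #|[set w' in cycles4 | cycle_edges w' == cycle_edges w]| = 8.
Proof.
case/tupleP: w => a w; case/tupleP: w => b w; case/tupleP: w => c w.
case/tupleP: w => d w; rewrite (tuple0 w) => {w} abcd.
pose neqs := (uniq4_eqF (cycles4_uniq abcd), eqxx); pose s := traversals a b c d.
have Us : uniq s.
  by apply: (@map_uniq _ _ (@tval 4 G)); rewrite /= !inE !eqseq_cons !neqs ?andbF.
transitivity #|[set w in s]|; last by rewrite cardsE (card_uniqP Us).
congr #|pred_of_set _|; apply/setP => w'; rewrite [LHS]inE [RHS]inE.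
apply/andP/idP => [[]|/(cycle_edges_traversals abcd)[-> ->]]; last by [].
case/tupleP: w' => a' w; case/tupleP: w => b' w; case/tupleP: w => c' w.
case/tupleP: w => d' w; rewrite (tuple0 w) => {w} abcd' /eqP E.
have := abcd'; rewrite cycles4E => /and3P[a'c' b'd' /and4P[]].
move=> /adj_neq a'b' /adj_neq b'c' /adj_neq c'd' _.
(* Every step of a traversal follows one of the 8 oriented edges. *)
have step x y : [set x; y] \in cycle_edges [tuple a'; b'; c'; d'] -> x != y ->
    (x, y) \in [:: (a, b); (b, c); (c, d); (d, a); (b, a); (c, b); (d, c); (a, d)].
  rewrite E cycle_edges4 ?cycles4_uniq // !inE -!orbA => /or4P[] /eqP e xy;
    by case: (set2_eq xy e) => -[-> ->]; rewrite !eqxx ?orbT.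
have [] : [/\ [set a'; b'] \in cycle_edges [tuple a'; b'; c'; d'],
              [set b'; c'] \in cycle_edges [tuple a'; b'; c'; d'] &
              [set c'; d'] \in cycle_edges [tuple a'; b'; c'; d']].
  by rewrite cycle_edges4 ?cycles4_uniq // !inE !eqxx ?orbT.
move=> /step/(_ a'b') e1 /step/(_ b'c') e2 /step/(_ c'd') e3.
rewrite /s /traversals !inE.
move: e1; rewrite !inE !xpair_eqE.
(* In each case a' != c' and then b' != d' leave one choice for c' and d'. *)
do 7?[case/orP]; case/andP=> /eqP ? /eqP ?; subst a' b';
 move: e2 a'c'; rewrite !inE !xpair_eqE !neqs /= ?orbF => /orP[] /eqP ?; subst c';
 rewrite ?neqs // => _;
 move: e3 b'd'; rewrite !inE !xpair_eqE !neqs /= ?orbF => /orP[] /eqP ?; subst d';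
 rewrite ?neqs // => _; by rewrite -!val_eqE /= ?eqxx ?orbT.
Qed.

Lemma card_cycles4 : #|cycles4| = 8 * #|squares G|.
Proof. exact: card_uniform_imset card_traversals. Qed.

(** Inclusion-exclusion on the coincidences a = c and b = d of a closed walk
    a b c d. With a = c imposed, what remains is a pair of edges at a, whence
    sum d^2 such walks, and likewise for b = d; with both imposed, an oriented
    edge remains. *)
Lemma squares_closed_walks4 :
  8 * #|squares G| + 2 * \sum_x deg x ^ 2 = \sum_x walks 4 x x + 2 * #|edges G|.
Proof.
have degE x : deg x ^ 2 = \sum_y \sum_z (adj x y && adj x z).
  rewrite -mulnn /deg big_distrlr; apply: eq_bigr => y _.
  by apply: eq_bigr => z _; rewrite /= mulnb.
have diag_ac : \sum_a \sum_b \sum_c \sum_d (closed4 a b c d && (c == a))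
               = \sum_x deg x ^ 2.
  apply: eq_bigr => a _; rewrite degE; apply: eq_bigr => b _.
  rewrite exchange_big; apply: eq_bigr => d _; rewrite sum_pick /closed4.
  by rewrite (adj_sym b a) (adj_sym d a); do 2!case: adj.
have diag_bd : \sum_a \sum_b \sum_c \sum_d (closed4 a b c d && (d == b))
               = \sum_x deg x ^ 2.
  rewrite exchange_big; apply: eq_bigr => b _; rewrite degE.
  apply: eq_bigr => a _; apply: eq_bigr => c _; rewrite sum_pick /closed4.
  by rewrite (adj_sym c b) (adj_sym a b); do 2!case: adj.
have diag_both : \sum_a \sum_b \sum_c \sum_d
    (closed4 a b c d && (c == a) && (d == b)) = 2 * #|edges G|.
  rewrite -sum_deg; apply: eq_bigr => a _; apply: eq_bigr => b _.
  under eq_bigr do rewrite sum_pick.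
  by rewrite sum_pick /closed4 (adj_sym b a); case: adj.
have cyclesE : #|cycles4| = \sum_a \sum_b \sum_c \sum_d
    [&& a != c, b != d & closed4 a b c d].
  rewrite -sum1_card big_mkcond sum_tuple_cons; apply: eq_bigr => a _.
  do 3![rewrite sum_tuple_cons; apply: eq_bigr => ? _].
  by rewrite sum_tuple_nil cycles4E; case: ifP.
rewrite -card_cycles4 cyclesE closed_walks4E mul2n -addnn -{1}diag_ac -diag_bd.
rewrite -diag_both.
(* All terms are now sums over the same quadruples: compare summands. *)
rewrite -!big_split; apply: eq_bigr => a _; rewrite -!big_split /=.
apply: eq_bigr => b _; rewrite -!big_split; apply: eq_bigr => c _ /=.
rewrite -!big_split; apply: eq_bigr => d _ /=; rewrite (eq_sym c) (eq_sym d).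
by case: (a == c); case: (b == d); case: closed4.
Qed.

(** * The three inequalities *)

(** Given oriented edges (a, b) and (c, d), at most one of a b c d and a b d c
    is a closed walk, for otherwise b, c, d is a triangle. Summing over all
    pairs of oriented edges gives 2 c_4 <= (2 m)^2. *)
Lemma closed_walks4_le : triangle_free G ->
  \sum_x walks 4 x x <= 2 * #|edges G| ^ 2.
Proof.
move=> tf; rewrite -(leq_pmul2l (isT : 0 < 2)) mulnA -(expnMn 2 _ 2) -sum_deg.
rewrite mul2n -addnn closed_walks4E.
have swap_cd : \sum_a \sum_b \sum_c \sum_d closed4 a b c d =
               \sum_a \sum_b \sum_c \sum_d closed4 a b d c.
  by apply: eq_bigr => a _; apply: eq_bigr => b _; rewrite exchange_big.
rewrite {2}swap_cd -big_split -mulnn big_distrlr leq_sum // => a _ /=.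
rewrite -big_split /deg.
under [leqRHS]eq_bigr do rewrite big_distrlr.
rewrite exchange_big leq_sum // => b _ /=.
rewrite -big_split leq_sum // => c _ /=; rewrite -big_split leq_sum // => d _ /=.
have := tf b c d; rewrite /closed4 (adj_sym d c) (adj_sym d b) (adj_sym c a).
by do 6!case: adj.
Qed.

(** Cauchy-Schwarz, as the sum of 2 d_x d_y <= d_x^2 + d_y^2 over all pairs of
    vertices. *)
Lemma sum_deg_sqr_ge : (2 * #|edges G|) ^ 2 <= #|G| * \sum_x deg x ^ 2.
Proof.
rewrite -sum_deg -(leq_pmul2l (isT : 0 < 2)).
have -> : 2 * (\sum_x deg x) ^ 2 = \sum_x \sum_y 2 * (deg x * deg y).
  rewrite -mulnn big_distrlr big_distrr; apply: eq_bigr => x _.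
  by rewrite big_distrr.
have -> : 2 * (#|G| * \sum_x deg x ^ 2) =
          \sum_x \sum_y (deg x ^ 2 + deg y ^ 2).
  under [RHS]eq_bigr do rewrite big_split sum_nat_const /=.
  by rewrite big_split sum_nat_const /= -big_distrr mul2n addnn.
by do 2![rewrite leq_sum // => ? _]; rewrite nat_Cauchy.
Qed.

(** The entries of A^3 - m A have nonnegative squares, and the sum of these
    squares is c_6 - 2 m c_4 + m^2 c_2. If m is the number of edges, the matrix
    vanishes on K_{k,k}, so nothing is lost in the case of equality. *)
Lemma closed_walks6_ge m :
  2 * m * \sum_x walks 4 x x <= \sum_x walks 6 x x + m ^ 2 * (2 * #|edges G|).
Proof.
have -> : \sum_x walks 6 x x = \sum_x \sum_y walks 3 x y ^ 2.
  exact: (closed_walks_sqr 3).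
have -> : \sum_x walks 4 x x = \sum_x \sum_y adj x y * walks 3 x y.
  apply: eq_bigr => x _; rewrite -[4]/(1 + 3) walksD; apply: eq_bigr => y _.
  by rewrite walks1 walksC.
rewrite -sum_deg !big_distrr -big_split leq_sum // => x _ /=.
rewrite !big_distrr -big_split leq_sum // => y _.
have [] := nat_Cauchy m (walks 3 x y); move: (walks 3 x y) => w.
by case: adj => Cw _ /=; rewrite ?mul0n ?muln0 // mul1n muln1 -mulnA addnC.
Qed.

End Graph.

Arguments walks : simpl never.

(** * The complete bipartite graph with equal parts *)

Section CompleteBipartite.
Variable k : nat.
Local Notation K := (Kbip k k).

Lemma sum_Kbip (F : K -> nat) :
  \sum_x F x = \sum_(i < k) F (inl i) + \sum_(i < k) F (inr i).
Proof. exact: big_sumType. Qed.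

Lemma deg_Kbip (x : K) : deg x = k.
Proof.
by rewrite /deg sum_Kbip; case: x => i /=;
   rewrite !sum_nat_const card_ord muln0 ?muln1 ?addn0.
Qed.

Lemma card_Kbip : #|K| = 2 * k.
Proof. by rewrite card_sum card_ord addnn mul2n. Qed.

Lemma card_edges_Kbip : #|edges K| = k ^ 2.
Proof.
apply/eqP; rewrite -(eqn_pmul2l (isT : 0 < 2)) -sum_deg.
under eq_bigr do rewrite deg_Kbip.
by rewrite sum_nat_const card_Kbip -mulnA mulnn.
Qed.

Lemma sum_deg_sqr_Kbip : \sum_(x : K) deg x ^ 2 = 2 * k ^ 3.
Proof.
under eq_bigr do rewrite deg_Kbip.
by rewrite sum_nat_const card_Kbip -mulnA -expnS.
Qed.

(** Non-adjacent vertices lie in the same part, so they have all k vertices of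
    the other part as common neighbours. *)
Lemma walks2_Kbip (x y : K) : walks 2 x y = k * ~~ adj x y.
Proof.
transitivity (deg x * ~~ adj x y); last by rewrite deg_Kbip.
rewrite (walksD 1 1) big_distrl; apply: eq_bigr => z _ /=.
by rewrite !walks1; case: x y z => [i|i] [j|j] [l|l].
Qed.

Lemma walks3_Kbip (x y : K) : walks 3 x y = k ^ 2 * adj x y.
Proof.
transitivity (deg x * k * adj x y); last by rewrite deg_Kbip mulnn.
rewrite (walksD 1 2) !big_distrl; apply: eq_bigr => z _.
rewrite walks1 walks2_Kbip /=.
by case: x y z => [i|i] [j|j] [l|l]; rewrite ?muln0 ?mul0n ?mul1n ?muln1.
Qed.

Lemma closed_walks4_Kbip : \sum_(x : K) walks 4 x x = 2 * k ^ 4.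
Proof.
transitivity (\sum_(x : K) k ^ 2 * deg x); last first.
  under eq_bigr do rewrite deg_Kbip -expnSr.
  by rewrite sum_nat_const card_Kbip -mulnA -expnS.
apply: eq_bigr => x _; rewrite -[4]/(1 + 3) walksD.
rewrite big_distrr; apply: eq_bigr => y _.
by rewrite walks1 walks3_Kbip adj_sym mulnCA mulnb andbb.
Qed.

Lemma closed_walks6_Kbip : \sum_(x : K) walks 6 x x = 2 * k ^ 6.
Proof.
transitivity (\sum_(x : K) k ^ 4 * deg x); last first.
  under eq_bigr do rewrite deg_Kbip -expnSr.
  by rewrite sum_nat_const card_Kbip -mulnA -expnS.
rewrite (closed_walks_sqr _ 3); apply: eq_bigr => x _.
rewrite big_distrr; apply: eq_bigr => y _.
by rewrite walks3_Kbip expnMn -expnM; case: adj.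
Qed.

Lemma triangle_free_Kbip : triangle_free K.
Proof. by move=> [] x [] y [] z. Qed.

End CompleteBipartite.

(** * The bound on closed walks of length 6 *)

Local Open Scope ring_scope.

Theorem corollary4p9 :
  (forall (G : sgraph) (n m q c6 : nat),
     n = #|G| -> m = #|edges G| -> q = #|squares G| ->
     c6 = #|closed_walks G 6| ->
     (0 < n)%N -> triangle_free G ->
     21 * m%:R * (4 * q%:R - m%:R) / 2 - (17 / 2 - 42 / n%:R) * m%:R ^+ 3
       <= c6%:R :> rat)
  /\
  (forall (n m q c6 : nat),
     (0 < n)%N -> ~~ odd n ->
     m = #|edges (Kbip n./2 n./2)| -> q = #|squares (Kbip n./2 n./2)| ->
     c6 = #|closed_walks (Kbip n./2 n./2) 6| ->
     [/\ #|Kbip n./2 n./2| = n,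
         triangle_free (Kbip n./2 n./2)
       & c6%:R = 21 * m%:R * (4 * q%:R - m%:R) / 2
                 - (17 / 2 - 42 / n%:R) * m%:R ^+ 3 :> rat]).
Proof.
split=> [G n m q c6 nE mE qE c6E n0 tf | n m q c6 n0 n_even mE qE c6E].
  have qc4 := squares_closed_walks4 G; have c4_le := closed_walks4_le tf.
  have D_ge := sum_deg_sqr_ge G; have c6_ge := closed_walks6_ge G m.
  rewrite -(card_closed_walks G 6) -c6E in c6_ge.
  rewrite -mE -?qE -?nE in qc4 c4_le D_ge c6_ge.
  move: (\sum_(x : G) walks 4 x x)%N (\sum_(x : G) deg x ^ 2)%N
    qc4 c4_le D_ge c6_ge => c4 D qc4 c4_le D_ge c6_ge.
  have {}qc4 : 8 * q%:R + 2 * D%:R = c4%:R + 2 * m%:R :> rat.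
    by rewrite -!natrM -!natrD qc4.
  have {}c4_le : c4%:R <= 2 * m%:R ^+ 2 :> rat.
    by rewrite -natrX -natrM ler_nat.
  have {}D_ge : 4 * m%:R ^+ 2 / n%:R <= D%:R :> rat.
    by rewrite ler_pdivrMr ?ltr0n // -natrX -!natrM ler_nat; lia.
  have {}c6_ge : 2 * m%:R * c4%:R <= c6%:R + 2 * m%:R ^+ 3 :> rat.
    by rewrite -natrX -!natrM -natrD ler_nat; lia.
  have m_ge0 : 0 <= m%:R :> rat by [].
  (* Multiplied by m, both bounds are linear in the monomials of the goal. *)
  have m_c4_le := ler_wpM2l m_ge0 c4_le; have m_D_ge := ler_wpM2l m_ge0 D_ge.
  have -> : 4 * q%:R - m%:R = c4%:R / 2 - D%:R :> rat by lra.
  by lra.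
have kE : (n./2 * 2 = n)%N.
  by rewrite -[RHS](odd_double_half n) (negPf n_even) muln2.
have k0 : n./2%:R != 0 :> rat by rewrite pnatr_eq0; lia.
split; [by rewrite card_Kbip mulnC | exact: triangle_free_Kbip |].
have qk := squares_closed_walks4 (Kbip n./2 n./2).
rewrite card_closed_walks closed_walks6_Kbip in c6E.
rewrite -qE closed_walks4_Kbip sum_deg_sqr_Kbip card_edges_Kbip in qk.
rewrite card_edges_Kbip in mE; rewrite -kE.
move: (n./2) mE c6E qk k0 => k -> -> qk k0.
have {}qk : 8 * q%:R + 4 * k%:R ^+ 3 = 2 * k%:R ^+ 4 + 2 * k%:R ^+ 2 :> rat.
  by rewrite -!natrX -!natrM -!natrD -qk mulnA.
(* This is the square of the number of pairs of vertices in one part. *)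
have -> : q%:R = (k%:R ^+ 4 - 2 * k%:R ^+ 3 + k%:R ^+ 2) / 4 :> rat by lra.
by rewrite natrM !natrX; field.
Qed.
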